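(* Let $N\geq 1$, $K\geq 1$ and $0\leq i\leq (N-1)\cdot K$ be natural numbers. (1) The Boltzmann-on-numbers distribution can be expressed purely in terms of $N$-nomials: $$\mathrm{BoN}[N,K](i) \;=\; \sum_{0\leq j<\min(N,i+1)} \frac{C_{N}(K-1,\,i-j)}{C_{N}(K,i)}\,|j\rangle .$$ (2) Let $S := \{v\in\boldsymbol{N}^{K}\mid \mathrm{sum}(v)=i\}$, where $\mathrm{sum}(v)$ is the sum of the entries of $v$, and let $\mathrm{uni} := \sum_{v\in S}\frac{1}{C_{N}(K,i)}|v\rangle$ be the uniform distribution on $S$. For $0\leq n<K$ let $\pi_{n}\colon \boldsymbol{N}^{K}\to\boldsymbol{N}$ be the $n$-th projection, $\pi_{n}(v)=v_{n}$ (with positions of $v$ indexed by $0,\ldots,K-1$). Then, for each $n$ with $0\leq n<K$, $$\mathcal{D}(\pi_{n})(\mathrm{uni}) \;=\; \mathrm{BoN}[N,K](i).$$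
   Context: For $N\geq 1$ write $\boldsymbol{N}=\{0,1,\ldots,N-1\}\subseteq\mathbb{N}$. For $K,i\in\mathbb{N}$, the $N$-nomial coefficient is the natural number $$C_{N}(K,i) := \big|\{(n_1,\ldots,n_K)\in\boldsymbol{N}^{K} \mid n_1+\cdots+n_K = i\}\big|,$$ which is $0$ when $i>(N-1)\cdot K$. A multiset over a set $X$ is a function $\varphi\colon X\to\mathbb{N}$ with finite support. Its size is $\|\varphi\| := \sum_{x}\varphi(x)$, and its multiset coefficient is $(\varphi) := \|\varphi\|!/\prod_{x}\varphi(x)!$. For $0\leq i\leq (N-1)\cdot K$, $\mathcal{M}[K,i](\boldsymbol{N})$ is the set of multisets $\varphi$ over $\boldsymbol{N}$ with $\|\varphi\|=K$ and $\sum_{0\leq j<N}\varphi(j)\cdot j=i$. $\mathcal{D}(X)$ is the set of finitely supported probability distributions on $X$, i.e. functions $\omega\colon X\to[0,1]$ with finite support and $\sum_x\omega(x)=1$. A formal sum $\sum_k r_k|x_k\rangle$ denotes the distribution giving weight $r_k$ to $x_k$ (weights of equal elements are added, terms with weight zero may be omitted). For a function $f\colon X\to Y$ the image distribution is $\mathcal{D}(f)\big(\sum_k r_k|x_k\rangle\big) := \sum_k r_k|f(x_k)\rangle\in\mathcal{D}(Y)$. For $N,K\geq 1$ and $0\leq i\leq (N-1)\cdot K$, the Boltzmann-on-numbers distribution $\mathrm{BoN}[N,K](i)\in\mathcal{D}(\boldsymbol{N})$ is $$\mathrm{BoN}[N,K](i) := \sum_{0\leq j<N}\ \sum_{\varphi\in\mathcal{M}[K,i](\boldsymbol{N})}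 \frac{(\varphi)\cdot\varphi(j)}{C_{N}(K,i)\cdot K}\,|j\rangle .$$ *)

(* Defs.v *)
From HB Require Import structures.
From mathcomp Require Export all_boot all_order all_algebra.
From mathcomp Require Export finmap multiset.
Set Implicit Arguments.
Unset Strict Implicit.
Unset Printing Implicit Defensive.

Import GRing.Theory Num.Theory.
Local Open Scope mset_scope.
Local Open Scope ring_scope.

Definition nnomial_support (N K i : nat) : {set K.-tuple 'I_N} :=
  [set v : K.-tuple 'I_N | (\sum_(l < K) tnth v l == i)%N].

Definition nnomial (N K i : nat) : nat := #|nnomial_support N K i|.

(* [size phi] is the cardinality with multiplicities of [phi], see [size_mset].
   The division is exact, see [mcoefM] below. *)
Definition mcoef (T : choiceType) (phi : {mset T}) : nat :=
  ((size phi)`! %/ \prod_(x <- finsupp phi) (phi x)`!)%N.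

(* M[K,i]({0,...,N-1}), specified by [in_msets] below.  Ranging over the
   multisets of entries of K-tuples only serves to exhibit the set as finite. *)
Definition msets (N K i : nat) : {fset {mset 'I_N}} :=
  [fset phi in [fset seq_mset (tval v) | v in {: K.-tuple 'I_N}]
      | (\sum_(j < N) phi j * j == i)%N]%fset.

Lemma in_msets (N K i : nat) (phi : {mset 'I_N}) :
  (phi \in msets N K i) =
  (size phi == K) && (\sum_(j < N) phi j * j == i)%N.
Proof.
rewrite !inE /=; congr (_ && _); apply/imfsetP/eqP => /= [[v _ ->]|szphi].
  by rewrite (perm_size (perm_eq_seq_mset v)) size_tuple.
exists (tcast szphi (in_tuple phi)) => //.
by rewrite val_tcast /= seq_mset_id.
Qed.

Section Dist.
Context {R : realFieldType}.

(* The one-term formal sum r|x>. Longer formal sums are sums of these in the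
   additive group {ffun X -> R}, which adds up the weights of equal elements. *)
Definition ket (X : finType) (r : R) (x : X) : {ffun X -> R} :=
  [ffun y => if y == x then r else 0].

(* Finite support is automatic, as X is finite. *)
Definition is_dist (X : finType) (w : {ffun X -> R}) : bool :=
  [forall x, 0 <= w x <= 1] && (\sum_x w x == 1).

Record dist (X : finType) := Dist {
  weight :> {ffun X -> R};
  weightP : is_dist weight }.

HB.instance Definition _ (X : finType) := [isSub for @weight X].

Lemma is_distP (X : finType) (w : {ffun X -> R}) :
  (forall x, 0 <= w x) -> \sum_x w x = 1 -> is_dist w.
Proof.
move=> w_ge0 w1; rewrite /is_dist w1 eqxx andbT; apply/forallP => x.
rewrite w_ge0 -w1 (bigD1 x) //= lerDl; exact: sumr_ge0.
Qed.

Lemma sum_ketE (X : finType) (I : Type) (s : seq I) (P : pred I) r (f : I -> X) y :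
  (\sum_(k <- s | P k) ket (r k) (f k) : {ffun X -> R}) y =
  \sum_(k <- s | P k) ket (r k) (f k) y.
Proof. by elim/big_rec2: _ => // [|k _ u _ <-]; rewrite ffunE. Qed.

Lemma ket_ge0 (X : finType) r (x y : X) : 0 <= r -> 0 <= ket r x y.
Proof. by move=> r_ge0; rewrite ffunE; case: ifP. Qed.

Lemma sum_ket (X : finType) r (x : X) : \sum_y ket r x y = r.
Proof.
rewrite (bigD1 x) //= ffunE eqxx big1 ?addr0 // => y yNx.
by rewrite ffunE (negPf yNx).
Qed.

Lemma ketD (X : finType) (x : X) r t : ket (r + t) x = ket r x + ket t x.
Proof.
by apply/ffunP => y; rewrite !ffunE; case: eqP => // _; rewrite addr0.
Qed.

Lemma ket_sum (X : finType) (I : Type) (s : seq I) (P : pred I) r (x : X) :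
  (\sum_(k <- s | P k) ket (r k) x : {ffun X -> R}) =
  ket (\sum_(k <- s | P k) r k) x.
Proof.
elim/big_rec2: _ => [|k t u _ ->]; last by rewrite ketD.
by apply/ffunP => y; rewrite !ffunE if_same.
Qed.

Lemma is_dist_kets (X : finType) (I : Type) (s : seq I) (P : pred I) r (f : I -> X) :
  (forall k, P k -> 0 <= r k) -> \sum_(k <- s | P k) r k = 1 ->
  is_dist (\sum_(k <- s | P k) ket (r k) (f k)).
Proof.
move=> r_ge0 r1; apply: is_distP => [y|].
  by rewrite sum_ketE; apply: sumr_ge0 => k Pk; apply/ket_ge0/r_ge0.
rewrite (eq_bigr (fun y => \sum_(k <- s | P k) ket (r k) (f k) y)); last first.
  by move=> y _; rewrite sum_ketE.
by rewrite exchange_big -[RHS]r1 /=; apply: eq_bigr => k _; rewrite sum_ket.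
Qed.

Lemma dist_map_subproof (X Y : finType) (f : X -> Y) (w : dist X) :
  is_dist (\sum_x ket (w x) (f x)).
Proof.
case: w => w /= /andP[/forallP w01 /eqP w1]; apply: is_dist_kets => // x _.
by case/andP: (w01 x).
Qed.

Definition dist_map (X Y : finType) (f : X -> Y) (w : dist X) : dist Y :=
  Dist (dist_map_subproof f w).

End Dist.
Arguments dist : clear implicits.

Lemma card_seq_mset (T : finType) (K : nat) (phi : {mset T}) : size phi = K ->
  (#|[set v : K.-tuple T | seq_mset v == phi]| * \prod_x (phi x)`! = K`!)%N.
Proof.
elim: K phi => [|K IHK] phi szphi.
  move: szphi => /eqP; rewrite size_mset_eq0 => /eqP ->.
  rewrite big1 => [|x _]; last by rewrite mset0E.
  rewrite muln1 (_ : [set v | _] = [set [tuple]]) ?cards1 //.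
  apply/finset.setP => v; rewrite !inE tuple0 [in RHS]eqxx; apply/eqP/msetP => x.
  by rewrite mset_seqE mset0E.
rewrite factS -[in RHS]szphi size_mset big_distrl /=.
have -> : (\sum_(a <- finsupp phi) phi a * K`! = \sum_a phi a * K`!)%N.
  rewrite -(big_rmcond_in _ (P := mem (finsupp phi)) (fun a => _)) /=;
    last by move=> a _; rewrite memNfinsupp => /eqP ->.
  rewrite [RHS](bigID (mem (finsupp phi))) /= [X in (_ + X)%N]big1 ?addn0;
    last by move=> a; rewrite memNfinsupp => /eqP ->.
  rewrite -[RHS]big_filter -[LHS]big_filter; apply: perm_big.
  rewrite uniq_perm ?filter_uniq ?index_enum_uniq ?fset_uniq // => a.
  by rewrite !mem_filter mem_index_enum andbT andbb.
have -> : #|[set v : K.+1.-tuple T | seq_mset v == phi]| =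
    (\sum_x #|[set v : K.-tuple T | (0 < phi x) &&
                  (seq_mset v == phi `\ x)%mset]|)%N.
  rewrite -sum1_card (partition_big (fun v : K.+1.-tuple T => thead v) predT) //=.
  apply: eq_bigr => x _; rewrite -sum1_card.
  rewrite (reindex_onto (fun v : K.-tuple T => [tuple of x :: v])
                        (fun v => [tuple of behead v])) /=.
    apply: eq_bigl => v; rewrite !inE theadE eqxx andbT /=.
    rewrite (_ : _ == v) ?andbT; last by apply/eqP/val_inj.
    rewrite mset_cons; apply/eqP/andP => [<-|[phix /eqP ->]].
      by rewrite mset1DE eqxx msetD1K.
    by rewrite msetB1K // in_mset.
  by move=> v /andP[_ /eqP <-]; rewrite [in RHS](tuple_eta v); apply/val_inj.
rewrite big_distrl /=; apply: eq_bigr => x _.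
case: (posnP (phi x)) => [->|phix].
  by rewrite (_ : [set v | _] = set0) ?cards0.
have szphix : size (phi `\ x)%mset = K.
  have /msetB1K phiE : x \in phi by rewrite in_mset.
  move: szphi; rewrite -{1}phiE -{1}[(phi `\ x)%mset]seq_mset_id -mset_cons.
  by rewrite (perm_size (perm_eq_seq_mset _)) /= => -[].
rewrite -(IHK _ szphix) mulnCA /=; congr (_ * _)%N.
rewrite (bigD1 x) //= [in RHS](bigD1 x) //= mulnA; congr (_ * _)%N.
  by rewrite msetB1E eqxx subn1 -[in LHS](prednK phix) factS prednK.
by apply: eq_bigr => y /negPf yNx; rewrite msetB1E yNx subn0.
Qed.

Lemma big_finsupp (T : finType) (phi : {mset T}) (R : Type) (e : R)
    (op : Monoid.com_law e) (F : T -> R) :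
  (forall x, phi x = 0%N -> F x = e) ->
  \big[op/e]_(x <- finsupp phi) F x = \big[op/e]_x F x.
Proof.
move=> F0; rewrite [RHS](bigID (mem (finsupp phi))) /= [X in op _ X]big1.
  rewrite Monoid.mulm1 -[RHS]big_filter; apply: perm_big.
  rewrite uniq_perm ?filter_uniq ?index_enum_uniq ?fset_uniq // => x.
  by rewrite mem_filter mem_index_enum andbT.
by move=> x; rewrite memNfinsupp => /eqP /F0.
Qed.

Lemma mcoef_card (T : finType) (K : nat) (phi : {mset T}) : size phi = K ->
  mcoef phi = #|[set v : K.-tuple T | seq_mset v == phi]|.
Proof.
move=> szphi; rewrite /mcoef big_finsupp => [|x ->//].
by rewrite szphi -(card_seq_mset szphi) mulnK // prodn_gt0 // => x; apply: fact_gt0.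
Qed.

Lemma mcoefM (T : finType) (phi : {mset T}) :
  (mcoef phi * \prod_(x <- finsupp phi) (phi x)`! = (size phi)`!)%N.
Proof.
by rewrite big_finsupp => [|x -> //]; rewrite (mcoef_card erefl) card_seq_mset.
Qed.

Lemma wsum_seq_mset (N K : nat) (v : K.-tuple 'I_N) :
  (\sum_(j < N) seq_mset v j * j = \sum_(l < K) tnth v l)%N.
Proof.
rewrite -(big_tuple _ _ v xpredT (fun j : 'I_N => nat_of_ord j)).
rewrite -(perm_big _ (perm_eq_seq_mset v)) /= sum_mset big_finsupp //.
by move=> j ->; rewrite mul0n.
Qed.

Lemma sum_mcoef (N K i : nat) :
  (\sum_(phi <- msets N K i) mcoef phi = nnomial N K i)%N.
Proof.
have mcoefE phi : phi \in msets N K i ->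
    mcoef phi = (\sum_(v : K.-tuple 'I_N) (phi == seq_mset v))%N.
  rewrite in_msets => /andP[/eqP szphi _].
  rewrite (mcoef_card szphi) -sum1dep_card [LHS]big_mkcond /=.
  by apply: eq_bigr => v _; rewrite eq_sym; case: eqP.
rewrite /nnomial (eq_big_seq _ mcoefE) exchange_big -sum1_card [RHS]big_mkcond /=.
apply: eq_bigr => v _; rewrite inE -wsum_seq_mset.
have -> : (\sum_(phi <- msets N K i) (phi == seq_mset v) =
           count_mem (seq_mset v) (msets N K i))%N.
  by rewrite -sum1_count [RHS]big_mkcond; apply: eq_bigr => phi _ /=; case: eqP.
rewrite count_uniq_mem ?fset_uniq // in_msets.
rewrite (perm_size (perm_eq_seq_mset v)) size_tuple eqxx /=.
by case: eqP.
Qed.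

Lemma nnomial_gt0 (N K i : nat) :
  (0 < N)%N -> (i <= (N - 1) * K)%N -> (0 < nnomial N K i)%N.
Proof.
move=> N_gt0; elim: K i => [|K IHK] i ile.
  apply/card_gt0P; exists [tuple]; rewrite inE big_ord0.
  by move: ile; rewrite muln0 leqn0 eq_sym.
have lt1 : (minn i (N - 1) < N)%N by rewrite (leq_ltn_trans (geq_minr _ _)) // subn1 prednK.
have /card_gt0P[v] : (0 < nnomial N K (i - minn i (N - 1)))%N.
  apply: IHK; move: ile; rewrite mulnS => ile.
  rewrite /minn; case: ltnP => _; first by rewrite subnn.
  by rewrite leq_subLR.
rewrite inE => /eqP vE; apply/card_gt0P; exists [tuple of Ordinal lt1 :: v].
rewrite inE big_ord_recl (tnth_nth (Ordinal lt1)) /=.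
under eq_bigr => l _ do rewrite (tnth_nth (Ordinal lt1)) /= -(tnth_nth _ v l).
by rewrite vE subnKC // geq_minl.
Qed.

Section BoN.
Context {R : realFieldType} (N K i : nat).
Hypotheses (N_gt0 : (0 < N)%N) (K_gt0 : (0 < K)%N) (le_i : (i <= (N - 1) * K)%N).

Definition BoN_weight : {ffun 'I_N -> R} :=
  \sum_(j < N) \sum_(phi <- msets N K i)
     ket ((mcoef phi * phi j)%N%:R / (nnomial N K i * K)%N%:R) j.

Lemma BoN_subproof : is_dist BoN_weight.
Proof.
rewrite /BoN_weight; under eq_bigr do rewrite ket_sum.
apply: is_dist_kets => [j _|].
  by apply: sumr_ge0 => phi _; rewrite divr_ge0 // ler0n.
rewrite exchange_big /=.
transitivity (\sum_(phi <- msets N K i) (mcoef phi)%:R / (nnomial N K i)%:R : R).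
  apply: eq_big_seq => phi; rewrite in_msets => /andP[/eqP szphi _].
  rewrite -mulr_suml -natr_sum -big_distrr /=.
  rewrite -(@big_finsupp _ phi _ 0%N addn (fun j => phi j)) //.
  rewrite -size_mset szphi !natrM -mulf_div.
  by rewrite divff ?mulr1 // pnatr_eq0 -lt0n.
rewrite -mulr_suml -natr_sum sum_mcoef divff // pnatr_eq0 -lt0n.
exact: nnomial_gt0.
Qed.

Definition BoN : dist R 'I_N := Dist BoN_subproof.

Definition uni_weight : {ffun K.-tuple 'I_N -> R} :=
  \sum_(v in nnomial_support N K i) ket (1 / (nnomial N K i)%:R) v.

Lemma uni_subproof : is_dist uni_weight.
Proof.
apply: is_dist_kets => [v _|]; first by rewrite divr_ge0 // ler0n.
rewrite div1r sumr_const -[_ *+ _]mulr_natl divff // pnatr_eq0 -lt0n.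
exact: nnomial_gt0.
Qed.

(* The uniform distribution on the tuples with entries adding up to i. *)
Definition uni : dist R (K.-tuple 'I_N) := Dist uni_subproof.

End BoN.

Arguments BoN R {N K i}.
Arguments uni R {N K i}.

(* Main.v *)
(** For each position n, exactly C_N(K-1, i-j) of the K-tuples with sum i have
    entry j at n (delete that entry), and none if j > i.  This is the weight of
    [j] in the n-th marginal of the uniform distribution, up to the factor
    1/C_N(K,i).  Since (phi) counts the tuples with multiset of entries phi,
    the sum of (phi) phi(j) counts the pairs of a tuple v with sum i and a
    position n with v_n = j, so it is K C_N(K-1, i-j). *)
Require Import Defs.
From mathcomp Require Import all_boot all_order all_algebra.
Import GRing.Theory Num.Theory.
Local Open Scope ring_scope.

(** The guard [j <= i] matters: for [i < j] truncated subtraction makes [i - j] zero, and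
    [nnomial N (K - 1) 0] is 1, not 0. *)
Lemma card_nnomial_support_tnth (N K i : nat) (n : 'I_K) (j : 'I_N) :
  #|[set v in nnomial_support N K i | tnth v n == j]| =
  (if (j <= i)%N then nnomial N (K - 1) (i - j) else 0%N).
Proof.
case: K n => [[] //|K] n; rewrite subn1 /=.
(* [ins] inserts [j] at position [n]; it is inverse to deleting that entry. *)
pose ins (v : K.-tuple 'I_N) : K.+1.-tuple 'I_N :=
  [tuple (if unlift n l is Some l' then tnth v l' else j) | l < K.+1].
have ins_n v : tnth (ins v) n = j by rewrite tnth_mktuple unlift_none.
have ins_lift v l : tnth (ins v) (lift n l) = tnth v l.
  by rewrite tnth_mktuple liftK.
have ins_inj : injective ins.
  by move=> v w vw; apply: eq_from_tnth => l; rewrite -!ins_lift vw.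
have sum_split (w : K.+1.-tuple 'I_N) :
    (\sum_(l < K.+1) tnth w l = tnth w n + \sum_(l < K) tnth w (lift n l))%N.
  by rewrite (bigD1_ord n).
case: leqP => [le_ji|lt_ij].
  rewrite /nnomial -(card_imset _ ins_inj); apply: eq_card => w.
  rewrite !inE sum_split; apply/andP/imsetP => [[/eqP wi /eqP wn]|[v + ->]].
    exists [tuple tnth w (lift n l) | l < K].
      by rewrite inE -wi wn addKn; under eq_bigr do rewrite tnth_mktuple.
    apply: eq_from_tnth => l; case: (unliftP n l) => [l'|] ->.
      by rewrite ins_lift tnth_mktuple.
    by rewrite ins_n.
  rewrite inE => /eqP vi; rewrite ins_n; split=> //.
  by under eq_bigr do rewrite ins_lift; rewrite vi subnKC.
apply: eq_card0 => w; rewrite !inE sum_split; apply/negP => /andP[/eqP wi /eqP wn].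
by move: lt_ij; rewrite -wi wn ltnNge leq_addr.
Qed.

(** Groups the tuples by their multiset of entries: the fibre over [phi] has [mcoef phi]
    elements. *)
Lemma sum_msets_mcoefM (N K i : nat) (F : {mset 'I_N}%mset -> nat) :
  (\sum_(phi <- msets N K i) mcoef phi * F phi =
   \sum_(v in nnomial_support N K i) F (seq_mset v))%N.
Proof.
have mcoefE phi : phi \in msets N K i -> (mcoef phi * F phi =
    \sum_(v : K.-tuple 'I_N | seq_mset v == phi) F (seq_mset v))%N.
  rewrite in_msets => /andP[/eqP szphi _].
  rewrite (mcoef_card szphi) -sum1dep_card big_distrl /=.
  by apply: eq_bigr => v /eqP ->; rewrite mul1n.
rewrite (eq_big_seq _ mcoefE) (exchange_big_dep xpredT) //= [RHS]big_mkcond /=.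
apply: eq_bigr => v _; rewrite big_const_seq iter_addn_0 mulnC.
rewrite (eq_count (a2 := pred1 (seq_mset v))); last by move=> phi /=; rewrite eq_sym.
(* After the exchange, [v] is counted once if [seq_mset v] lies in [msets N K i], that is, if [v]
   has sum [i], and not at all otherwise. *)
rewrite count_uniq_mem ?fset_uniq // in_msets wsum_seq_mset.
rewrite (perm_size (perm_eq_seq_mset v)) size_tuple eqxx inE.
by case: eqP => _; rewrite ?mul1n ?mul0n.
Qed.

Lemma sum_mcoef_mult (N K i : nat) (j : 'I_N) :
  (\sum_(phi <- msets N K i) mcoef phi * phi j =
   K * if (j <= i)%N then nnomial N (K - 1) (i - j) else 0)%N.
Proof.
rewrite (sum_msets_mcoefM _ _ _ (fun phi => phi j)).
transitivity (\sum_(v in nnomial_support N K i) \sum_(l < K) (tnth v l == j))%N.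
  apply: eq_bigr => v _; rewrite mset_seqE -sum1_count big_mkcond big_tuple /=.
  by apply: eq_bigr => l _; case: eqP.
(* With the position [l] outermost, all [K] terms are equal, since the count does not depend on
   [l]. *)
rewrite exchange_big [RHS]mulnC -iter_addn_0 -big_const_ord.
apply: eq_bigr => l _; rewrite -(card_nnomial_support_tnth _ _ _ l) -sum1_card.
by under [RHS]eq_bigl do rewrite inE; rewrite [RHS]big_mkcondr.
Qed.

Lemma sum_ket_id (R : realFieldType) (X : finType) (P : pred X) (r : X -> R) y :
  (\sum_(x | P x) ket (r x) x : {ffun X -> R}) y = if P y then r y else 0.
Proof.
rewrite sum_ketE big_mkcond (bigD1 y) //= ffunE eqxx big1 ?addr0 // => x xNy.
by rewrite ffunE eq_sym (negPf xNy) if_same.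
Qed.

Section Weights.
Context (R : realFieldType) (N K i : nat).
Hypotheses (N_gt0 : (0 < N)%N) (K_gt0 : (0 < K)%N) (le_i : (i <= (N - 1) * K)%N).

Lemma BoNE (j : 'I_N) : BoN R N_gt0 K_gt0 le_i j =
  (if (j <= i)%N then nnomial N (K - 1) (i - j) else 0%N)%:R / (nnomial N K i)%:R.
Proof.
rewrite /= /BoN_weight; under eq_bigr do rewrite ket_sum.
rewrite (sum_ket_id _ _ xpredT) -mulr_suml -natr_sum sum_mcoef_mult.
(* The factor [K] from the choice of position cancels the [K] in the denominator. *)
by rewrite mulnC !natrM -mulf_div divff ?mulr1 // pnatr_eq0 -lt0n.
Qed.

Lemma dist_map_tnth_uniE (n : 'I_K) (j : 'I_N) :
  dist_map (fun v : K.-tuple 'I_N => tnth v n) (uni R N_gt0 le_i) j =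
  (if (j <= i)%N then nnomial N (K - 1) (i - j) else 0%N)%:R / (nnomial N K i)%:R.
Proof.
rewrite /= sum_ketE -(card_nnomial_support_tnth _ _ _ n) -sum1_card natr_sum.
rewrite mulr_suml [RHS]big_mkcond; apply: eq_bigr => v _.
rewrite ffunE /uni_weight sum_ket_id inE eq_sym.
by case: (v \in _); case: eqP.
Qed.

End Weights.

Theorem proposition2 (R : realFieldType) (N K i : nat)
    (N_gt0 : (0 < N)%N) (K_gt0 : (0 < K)%N) (le_i : (i <= (N - 1) * K)%N) :
  (weight (BoN R N_gt0 K_gt0 le_i) =
     \sum_(j < N | (j < minn N (i + 1))%N)
        ket ((nnomial N (K - 1) (i - j))%:R / (nnomial N K i)%:R : R) j)
  /\
  (forall n : 'I_K,
     dist_map (fun v : K.-tuple 'I_N => tnth v n) (uni R N_gt0 le_i)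
     = BoN R N_gt0 K_gt0 le_i).
Proof.
split=> [|n]; last first.
  by apply/val_inj/ffunP => j; rewrite [LHS]dist_map_tnth_uniE [RHS]BoNE.
(* For [j : 'I_N] the bound [minn N (i + 1)] reduces to the guard [j <= i]. *)
apply/ffunP => j; rewrite BoNE sum_ket_id leq_min ltn_ord addn1 ltnS /=.
by case: leqP => // _; rewrite mul0r.
Qed.
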